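(* Let $n\ge2$ and let $K$ be an algebraically closed field of characteristic $p>0$ (so $K\supset\mathbb{F}_q$). Let $V(\Delta_n):=\{\underline a\in K^n : \Delta_n(\underline a)=0\}$. The map $$\varphi:K^n\to K^n,\qquad \underline a=(a_1,\dots,a_n)\mapsto\big(\Delta_{n-1}(\underline{\hat a_i})\big)_{1\le i\le n}$$ induces a surjective map from $K^n\setminus V(\Delta_n)$ onto itself. Moreover, for $\underline a,\underline{a'}\in K^n\setminus V(\Delta_n)$, one has $\varphi(\underline a)=\varphi(\underline{a'})$ if and only if $\underline{a'}=\lambda\underline a$ for some $\lambda\in K$ with $\lambda^{1+q+\cdots+q^{n-2}}=1$.
   Context: $q=p^s$ is a power of $p$. For $\underline a=(a_1,\dots,a_n)\in K^n$, $\Delta_n(\underline a):=\det\big(a_j^{q^{i-1}}\big)_{1\le i,j\le n}$ is the Moore determinant, and $\underline{\hat a_i}:=(a_1,\dots,a_{i-1},a_{i+1},\dots,a_n)$. *)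

(* Defs.v *)
From HB Require Import structures.
From mathcomp Require Import all_boot all_order all_algebra.

Set Implicit Arguments.
Unset Strict Implicit.
Unset Printing Implicit Defensive.

Import GRing.Theory.
Local Open Scope ring_scope.

(* Rows are indexed from 0, so the exponent q^(i-1) of row i (counted from 1)
   is written q ^ i. *)
Definition moore_det (K : fieldType) (q n : nat) (a : 'rV[K]_n) : K :=
  \det (\matrix_(i < n, j < n) a 0 j ^+ (q ^ i)%N).

(* V(Delta_n), as a subset of K^n. *)
Definition moore_zeros (K : fieldType) (q n : nat) : {pred 'rV[K]_n} :=
  [pred a | moore_det q a == 0].
Arguments moore_zeros : clear implicits.

(* col' i a : 'rV_n.-1 is the vector a with its i-th entry removed. *)
Definition moore_phi (K : fieldType) (q n : nat) (a : 'rV[K]_n) : 'rV[K]_n :=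
  \row_(i < n) moore_det q (col' i a).

(* Main.v *)
(** For [a, b] in [K^n] put [<a, b> := \sum_j (-1)^j a_j b_j], and write [F] for
    the coordinatewise [q]-th power.  Expanding Moore determinants along their
    last and first rows gives [<F^i a, phi a> = 0] for [i < n - 1] and
    [<a, F (phi a)> = Delta a].  Hence the matrix of all [<F^(k+1) (phi a), F^i a>]
    is triangular with diagonal entries powers of [Delta a], so [phi] preserves
    the complement of [V(Delta_n)].  If [a] is outside [V(Delta_n)], then [phi a]
    spans the orthogonal of [a, F a, ..., F^(n-2) a]; since [F] is bijective,
    this means that [F^(n-2) a] spans the orthogonal of [b, F b, ..., F^(n-2) b]
    for [b := phi a].  So [a] is determined by [b] up to a scalar, and
    conversely [F^-(n-2) (phi b)] is, up to a scalar, a preimage of [b].  Scalars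
    are adjusted by the homogeneity of [phi]. *)

Require Import Defs.
From mathcomp Require Import all_boot all_order all_algebra.

Set Implicit Arguments.
Unset Strict Implicit.
Unset Printing Implicit Defensive.

Import GRing.Theory.
Local Open Scope ring_scope.

(** * Additivity of powers in positive characteristic *)

Section PcharPowers.

Variables (K : fieldType) (Q : nat).
Hypothesis pcharQ : [pchar K].-nat Q.

Lemma pchar_nat_gt0 : (0 < Q)%N.
Proof. by case/andP: pcharQ. Qed.

Lemma expf_eq0_pchar (x : K) : (x ^+ Q == 0) = (x == 0).
Proof. by rewrite expf_eq0 pchar_nat_gt0. Qed.

Lemma expr_sum_pchar (I : Type) (r : seq I) (P : pred I) (f : I -> K) :
  (\sum_(i <- r | P i) f i) ^+ Q = \sum_(i <- r | P i) f i ^+ Q.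
Proof.
apply: (big_morph (fun x : K => x ^+ Q)) => [x y|]; first exact: exprDn_pchar.
by apply/eqP; rewrite expf_eq0_pchar.
Qed.

Lemma expr_sign_pchar i : ((-1) ^+ i : K) ^+ Q = (-1) ^+ i.
Proof. by rewrite exprAC exprNn_pchar // expr1n. Qed.

Lemma expr_det_pchar n (A : 'M[K]_n) :
  (\det A) ^+ Q = \det (map_mx (fun x => x ^+ Q) A).
Proof.
rewrite /determinant expr_sum_pchar; apply: eq_bigr => s _.
rewrite exprMn expr_sign_pchar -prodrXl; congr (_ * _).
by apply: eq_bigr => i _; rewrite mxE.
Qed.

Lemma expr_inj_pchar : injective (fun x : K => x ^+ Q).
Proof.
move=> x y /= /eqP; rewrite -subr_eq0 -exprNn_pchar // -exprDn_pchar //.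
by rewrite expf_eq0_pchar subr_eq0 => /eqP.
Qed.

End PcharPowers.

Lemma closed_field_nth_root (K : closedFieldType) (N : nat) (c : K) :
  (0 < N)%N -> exists x : K, x ^+ N = c.
Proof.
move=> N_gt0.
have /closed_rootP[x] : size ('X^N - c%:P : {poly K}) != 1%N.
  by rewrite size_XnsubC //; case: N N_gt0.
by rewrite /root !hornerE subr_eq0 => /eqP <-; exists x.
Qed.

(** * The alternating pairing and Frobenius *)

Section AlternatingPairing.

Variables (K : fieldType) (n : nat).
Implicit Types a b x y : 'rV[K]_n.

Definition powmx Q a : 'rV[K]_n := map_mx (fun z => z ^+ Q) a.

(** The signs are those of a cofactor expansion along a row: pairing a row with a vector of minors
    gives, up to sign, a determinant. *)
Definition altdot a b : K := \sum_(j < n) (-1) ^+ j * (a 0 j * b 0 j).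

Lemma altdotC a b : altdot a b = altdot b a.
Proof. by apply: eq_bigr => j _; rewrite [a 0 j * _]mulrC. Qed.

Lemma altdotB_scale a c x y :
  altdot a (x - c *: y) = altdot a x - c * altdot a y.
Proof.
rewrite /altdot mulr_sumr -sumrB; apply: eq_bigr => j _.
by rewrite !mxE !mulrBr [a 0 j * (c * _)]mulrCA [c * _]mulrCA.
Qed.

Lemma altdot_powmx Q a b : [pchar K].-nat Q ->
  altdot (powmx Q a) (powmx Q b) = altdot a b ^+ Q.
Proof.
move=> pQ; rewrite expr_sum_pchar //; apply: eq_bigr => j _.
by rewrite !mxE !exprMn expr_sign_pchar.
Qed.

Lemma powmxM Q Q' a : powmx (Q * Q') a = powmx Q' (powmx Q a).
Proof. by apply/rowP=> j; rewrite !mxE exprM. Qed.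

Lemma powmx_inj Q : [pchar K].-nat Q -> injective (powmx Q).
Proof.
move=> pQ a b /rowP eq_ab; apply/rowP=> j; have := eq_ab j; rewrite !mxE.
exact: expr_inj_pchar.
Qed.

Lemma powmxZ Q c a : powmx Q (c *: a) = c ^+ Q *: powmx Q a.
Proof. by apply/rowP=> j; rewrite !mxE exprMn. Qed.

End AlternatingPairing.

Lemma powmx_surj (K : closedFieldType) (n Q : nat) (b : 'rV[K]_n) :
  (0 < Q)%N -> exists a, powmx Q a = b.
Proof.
move=> Q_gt0; have rt j := closed_field_nth_root (b 0 j) Q_gt0.
have [f fE] := fin_all_exists rt.
by exists (\row_j f j); apply/rowP=> j; rewrite !mxE.
Qed.

(** * Homogeneity of Moore determinants *)

Lemma moore_detZ (K : fieldType) (q n : nat) (c : K) (a : 'rV[K]_n) :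
  moore_det q (c *: a) = c ^+ (\sum_(i < n) q ^ i)%N * moore_det q a.
Proof.
rewrite -prodrXr.
have -> : \prod_(i < n) c ^+ (q ^ i)%N
          = \det (diag_mx (\row_(i < n) c ^+ (q ^ i)%N)).
  by rewrite det_diag; apply: eq_bigr => i _; rewrite mxE.
rewrite -det_mulmx mul_diag_mx; congr (\det _); apply/matrixP=> i j.
by rewrite !mxE exprMn.
Qed.

Lemma moore_phiZ (K : fieldType) (q n : nat) (c : K) (a : 'rV[K]_n) :
  moore_phi q (c *: a) = c ^+ (\sum_(i < n.-1) q ^ i)%N *: moore_phi q a.
Proof.
apply/rowP=> j; rewrite !mxE -moore_detZ; congr (moore_det _ _).
by apply/rowP=> k; rewrite !mxE.
Qed.

(** * Orthogonality between Frobenius powers of [a] and [moore_phi q a] *)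

Section Moore.

Variables (K : fieldType) (q m : nat).
Hypothesis pcharq : [pchar K].-nat q.
Local Notation n := m.+2.
Implicit Types a b x y : 'rV[K]_n.

Definition moore_mx a : 'M[K]_n := \matrix_(i < n, j < n) a 0 j ^+ (q ^ i)%N.

Let pcharqX k : [pchar K].-nat (q ^ k)%N.
Proof. by rewrite pnatX pcharq. Qed.

Lemma moore_det_powmx k a :
  moore_det q (powmx (q ^ k) a) = moore_det q a ^+ (q ^ k).
Proof.
rewrite /moore_det expr_det_pchar //; congr (\det _).
by apply/matrixP=> i j; rewrite !mxE exprAC.
Qed.

Lemma moore_det0 : moore_det q (0 : 'rV[K]_n) = 0.
Proof.
rewrite -(scale0r 0) moore_detZ expr0n big_ord_recl expn0 add1n.
by rewrite mul0r.
Qed.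

Lemma altdot_powmx_shift k i a b :
  altdot (powmx (q ^ (k + i)) a) (powmx (q ^ k) b)
  = altdot (powmx (q ^ i) a) b ^+ (q ^ k).
Proof. by rewrite addnC expnD powmxM altdot_powmx. Qed.

(** The last row of [A] is left free: the minors along it involve only the Moore rows above, hence
    are the entries of [moore_phi q a]. *)
Lemma altdot_last_row (A : 'M[K]_n) a :
  (forall (i : 'I_n) j, (i < m.+1)%N -> A i j = a 0 j ^+ (q ^ i)) ->
  altdot (row ord_max A) (moore_phi q a) = (-1) ^+ m.+1 * \det A.
Proof.
move=> Aa; rewrite (expand_det_row A ord_max) mulr_sumr.
apply: eq_bigr => j _; rewrite /cofactor !mxE exprD.
have -> : moore_det q (col' j a) = \det (row' ord_max (col' j A)).
  congr (\det _); apply/matrixP=> i k; rewrite !mxE Aa lift_max //.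
rewrite mulrCA [RHS]mulrCA; congr (_ * _).
by rewrite !mulrA -expr2 sqrr_sign mul1r.
Qed.

Lemma altdot_moore_phi i a : (i < m.+1)%N ->
  altdot (powmx (q ^ i) a) (moore_phi q a) = 0.
Proof.
move=> lt_i_m.
(* [A] is the Moore matrix with its last row replaced by a second copy of row [i], so its
   determinant vanishes. *)
pose f (k : 'I_n) := if (k < m.+1)%N then k : nat else i.
pose A : 'M[K]_n := \matrix_(k, j) a 0 j ^+ (q ^ f k).
have -> : powmx (q ^ i) a = row ord_max A.
  by apply/rowP=> j; rewrite !mxE /f ltnn.
rewrite altdot_last_row => [|k j lt_k_m]; last by rewrite mxE /f lt_k_m.
have lt_i_n : (i < n)%N by apply: ltnW.
rewrite (@determinant_alternate _ _ A (Ordinal lt_i_n) ord_max) ?mulr0 //.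
  by rewrite -val_eqE neq_ltn /= lt_i_m.
by move=> j; rewrite !mxE /f /= lt_i_m ltnn.
Qed.

(** Without its first row, the Moore matrix consists of [q]-th powers of smaller Moore rows, so the
    minors are [q]-th powers of the entries of [moore_phi q a]. *)
Lemma altdot_powmx_moore_phi a :
  altdot (powmx q (moore_phi q a)) a = moore_det q a.
Proof.
rewrite /moore_det (expand_det_row _ ord0).
apply: eq_bigr => j _; rewrite /cofactor !mxE add0n expn0 expr1 [RHS]mulrCA.
rewrite [_ * a 0 j]mulrC; congr (_ * (_ * _)).
rewrite /moore_det expr_det_pchar //; congr (\det _).
by apply/matrixP=> i k; rewrite !mxE /= expnSr exprM.
Qed.

Lemma moore_phi_regular a :
  moore_det q a != 0 -> moore_det q (moore_phi q a) != 0.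
Proof.
move=> a_reg; set b := moore_phi q a.
pose D : 'M[K]_n := diag_mx (\row_(j < n) (-1) ^+ j).
pose P := moore_mx (powmx q b) *m D *m (moore_mx a)^T.
have PE k i : P k i = altdot (powmx (q ^ k.+1) b) (powmx (q ^ i) a).
  rewrite mxE; apply: eq_bigr => j _.
  by rewrite mul_mx_diag !mxE expnS exprM mulrAC mulrC.
have P_trig : is_trig_mx P.
  (* For [k < i], the entry is a power of the pairing of [powmx (q ^ (i - k.+1)) a] with [b], where
     [i - k.+1 < m.+1]. *)
  apply/is_trig_mxP=> k i lt_ki; rewrite PE altdotC.
  rewrite -[X in powmx (q ^ X) a](subnKC lt_ki) altdot_powmx_shift.
  apply/eqP; rewrite expf_eq0_pchar // altdot_moore_phi //.
  by rewrite (leq_ltn_trans (leq_sub2r _ (leq_ord i))) // subSS ltnS leq_subr.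
have : \det P != 0.
  rewrite det_trig //; apply/prodf_neq0=> i _; rewrite PE -[i.+1]addn1.
  by rewrite altdot_powmx_shift expn1 altdot_powmx_moore_phi expf_neq0.
rewrite !det_mulmx !mulf_eq0 !negb_or => /andP[/andP[+ _] _].
rewrite -[q in powmx q]expn1 [\det _]moore_det_powmx.
by rewrite (expf_eq0_pchar (pcharqX 1)).
Qed.

(** After the signs are absorbed into [x], it lies in the kernel of an invertible Moore matrix. *)
Lemma moore_nondegenerate a x : moore_det q a != 0 ->
  (forall i : 'I_n, altdot (powmx (q ^ i) a) x = 0) -> x = 0.
Proof.
move=> a_reg orth.
have Mx0 : moore_mx a *m (\col_(j < n) ((-1) ^+ j * x 0 j)) = 0.
  apply/colP=> i; rewrite !mxE -[RHS](orth i); apply: eq_bigr => j _.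
  by rewrite !mxE mulrCA.
have Mu : moore_mx a \in unitmx by rewrite unitmxE unitfE.
have /colP x0 := congr1 (mulmx (invmx (moore_mx a))) Mx0.
apply/rowP=> j; have := x0 j; rewrite mulKmx // mulmx0 !mxE => /eqP.
by rewrite mulf_eq0 signr_eq0 => /eqP.
Qed.

Lemma moore_orthogonal_line a x y : moore_det q a != 0 -> y != 0 ->
    (forall i, (i < m.+1)%N -> altdot (powmx (q ^ i) a) x = 0) ->
    (forall i, (i < m.+1)%N -> altdot (powmx (q ^ i) a) y = 0) ->
  exists c, x = c *: y.
Proof.
move=> a_reg y_neq0 ox oy; pose d := altdot (powmx (q ^ m.+1) a).
have dy_neq0 : d y != 0.
  apply: contraNneq y_neq0 => dy0; apply/eqP/(moore_nondegenerate a_reg) => i.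
  by have := leq_ord i; rewrite leq_eqVlt => /predU1P[-> //|/oy].
(* This ratio makes [x - c *: y] orthogonal to the one remaining Frobenius power as well. *)
exists (d x / d y); apply/subr0_eq/(moore_nondegenerate a_reg) => i.
rewrite altdotB_scale; have := leq_ord i; rewrite leq_eqVlt.
case/predU1P=> [->|lt_im]; first by rewrite -/(d x) -/(d y) divfK ?subrr.
by rewrite ox ?oy ?mulr0 ?subr0.
Qed.

(* Orthogonality is Frobenius-invariant, which exchanges the two arguments. *)
Lemma moore_orthogonal_dual a b :
    (forall i, (i < m.+1)%N -> altdot (powmx (q ^ i) a) b = 0) <->
    (forall i, (i < m.+1)%N -> altdot (powmx (q ^ i) b) (powmx (q ^ m) a) = 0).
Proof.
have shift i : (i < m.+1)%N ->
    altdot (powmx (q ^ i) b) (powmx (q ^ m) a)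
    = altdot (powmx (q ^ (m - i)) a) b ^+ (q ^ i).
  by rewrite ltnS altdotC => le_im; rewrite -altdot_powmx_shift subnKC.
split=> orth i lt_im.
  by apply/eqP; rewrite shift // expf_eq0_pchar // orth // ltnS leq_subr.
have lt_mi : (m - i < m.+1)%N by rewrite ltnS leq_subr.
have /eqP := orth _ lt_mi; rewrite shift // subKn //.
by rewrite expf_eq0_pchar // => /eqP.
Qed.

Lemma moore_regular_neq0 a : moore_det q a != 0 -> a != 0.
Proof. by apply: contraNneq => ->; rewrite moore_det0. Qed.

(** By duality, both vectors lie on the line orthogonal to the first [m.+1] Frobenius powers of the
    common image. *)
Lemma moore_phi_fiber a a' : moore_det q a != 0 -> moore_det q a' != 0 ->
  moore_phi q a = moore_phi q a' ->
  exists c, powmx (q ^ m) a' = c *: powmx (q ^ m) a.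
Proof.
move=> a_reg a'_reg eq_phi.
apply: (@moore_orthogonal_line (moore_phi q a)) => [|||].
- exact: moore_phi_regular.
- by apply: moore_regular_neq0; rewrite moore_det_powmx expf_neq0.
- apply: (moore_orthogonal_dual _ _).1 => i lt_im.
  by rewrite eq_phi altdot_moore_phi.
- by apply: (moore_orthogonal_dual _ _).1 => i lt_im; rewrite altdot_moore_phi.
Qed.

End Moore.

Theorem proposition5p1 (K : closedFieldType) (p s q n : nat)
    (charK : p \in [pchar K]) (s_gt0 : (0 < s)%N) (qE : q = (p ^ s)%N)
    (n_ge2 : (2 <= n)%N) :
  [/\ forall a : 'rV[K]_n,
        a \notin moore_zeros K q n -> moore_phi q a \notin moore_zeros K q n,
      forall b : 'rV[K]_n,
        b \notin moore_zeros K q n ->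
        exists2 a : 'rV[K]_n, a \notin moore_zeros K q n & moore_phi q a = b
    & forall a a' : 'rV[K]_n,
        a \notin moore_zeros K q n -> a' \notin moore_zeros K q n ->
        (moore_phi q a = moore_phi q a' <->
         exists2 lambda : K,
           lambda ^+ (\sum_(i < n.-1) q ^ i)%N = 1 & a' = lambda *: a)].
Proof.
case: n n_ge2 => [|[|m]] // _.
have pq : [pchar K].-nat q.
  by rewrite qE pnatX pnatE ?(pcharf_prime charK) ?charK.
have pqX k : [pchar K].-nat (q ^ k)%N by rewrite pnatX pq.
split=> [a|b|a a']; rewrite ?inE.
- exact: moore_phi_regular.
- move=> b_reg.
  have [a aE] := powmx_surj (moore_phi q b) (pchar_nat_gt0 (pqX m)).
  have a_reg : moore_det q a != 0.
    have := moore_phi_regular pq b_reg.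
    by rewrite -aE moore_det_powmx // expf_eq0_pchar.
  (* Since [powmx (q ^ m) a] is [moore_phi q b], duality puts [b] on the line spanned by
     [moore_phi q a]. *)
  have [|||mu bE] := @moore_orthogonal_line _ q m a b (moore_phi q a) a_reg.
  + exact/moore_regular_neq0/moore_phi_regular.
  + apply: (moore_orthogonal_dual pq _ _).2 => i; rewrite aE.
    exact: altdot_moore_phi.
  + by move=> i; apply: altdot_moore_phi.
  (* The exponent is the degree of homogeneity of [moore_phi], so rescaling [a] by this root absorbs
     [mu]. *)
  have [|lambda lambdaE] := @closed_field_nth_root K (\sum_(i < m.+1) q ^ i) mu.
    by rewrite big_ord_recl expn0.
  have phiE : moore_phi q (lambda *: a) = b by rewrite moore_phiZ lambdaE -bE.
  exists (lambda *: a); rewrite // inE moore_detZ mulf_neq0 // expf_neq0 //.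
  apply: contraTneq b_reg => lambda0; rewrite bE -lambdaE lambda0.
  by rewrite expr0n big_ord_recl expn0 scale0r moore_det0 eqxx.
- move=> a_reg a'_reg; split=> [eq_phi|[lambda lambda1 ->]]; last first.
    by rewrite moore_phiZ lambda1 scale1r.
  have [c] := moore_phi_fiber pq a_reg a'_reg eq_phi.
  (* Writing [c] as a [q ^ m]-th power allows Frobenius to be cancelled. *)
  have [lambda <-] := closed_field_nth_root c (pchar_nat_gt0 (pqX m)).
  rewrite -powmxZ => /powmx_inj a'E; exists lambda; last exact: a'E.
  move: eq_phi; rewrite a'E // moore_phiZ => /eqP.
  rewrite -subr_eq0 -{1}[moore_phi q a]scale1r -scalerBl scaler_eq0 subr_eq0.
  rewrite (negPf (moore_regular_neq0 (moore_phi_regular pq a_reg))) orbF.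
  by move/eqP->.
Qed.
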